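(* Let $n\ge1$, let row $i$ be a horizontal strip row with spectral parameter $x_i$ and let row $j$ be a vertical strip row with spectral parameter $y_j$. Then the rectangular vertex weights of these rows together with the $HV$ weights of $R^{(n)}$-vertices satisfy the Yang–Baxter equation: for all boundary labels $a,\alpha\in\{\wedge,\vee\}$ and $b,c,\beta,\gamma\in\{<,>\}^n$, $$\sum_{\boldsymbol I,\boldsymbol J,\delta}\operatorname{wt}\!\big(R(\boldsymbol I,\boldsymbol J,c,b)\big)\,\operatorname{wt}_{i}\!\big(a,\delta;\boldsymbol I,\gamma\big)\,\operatorname{wt}_{j}\!\big(\delta,\alpha;\boldsymbol J,\beta\big)=\sum_{\boldsymbol K,\boldsymbol L,\xi}\operatorname{wt}_{j}\!\big(a,\xi;b,\boldsymbol L\big)\,\operatorname{wt}_{i}\!\big(\xi,\alpha;c,\boldsymbol K\big)\,\operatorname{wt}\!\big(R(\gamma,\beta,\boldsymbol K,\boldsymbol L)\big),$$ where the sums run over $\boldsymbol I,\boldsymbol J,\boldsymbol K,\boldsymbol L\in\{<,>\}^n$ and $\delta,\xi\in\{\wedge,\vee\}$.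
   Context: **Rectangular vertices.** An $n$-ribbon vertex $v$ has labels $v_N,v_S\in\{\wedge,\vee\}$ (arrows up/down) on the vertical edges above and below it, and $n$-tuples $v_W,v_E\in\{<,>\}^n$ (arrows left/right) on its left and right sides, with components $v_W(k),v_E(k)$, $1\le k\le n$, where $k=1$ is the bottom strand and $k=n$ the top strand. It is admissible if the number of arrows pointing in equals the number pointing out and $v_E(k)=v_W(k+1)$ for $1\le k\le n-1$. An admissible vertex has one of six types, given by $(v_N,v_S,v_W(1),v_E(n))$: SW: $(\wedge,\wedge,>,>)$; NS: $(\vee,\wedge,<,>)$; SE: $(\wedge,\wedge,<,<)$; NW: $(\vee,\vee,>,>)$; EW: $(\wedge,\vee,>,<)$; NE: $(\vee,\vee,<,<)$. Let $s$ be the number of left arrows among $v_E(1),\dots,v_E(n-1)$. In a horizontal strip row with spectral parameter $x$ the weights are: SW: $q^s$; NS: $q^s$; SE: $0$; NW: $1$; EW: $q^sx$; NE: $q^sx$. In a vertical strip row with spectral parameter $y$ the weights are: SW: $q^s$; NS: $1$; SE: $-y$; NW: $1$; EW: $-y$; NE: $0$. Non-admissible vertices have weight $0$. For tuples $P,Q\in\{<,>\}^n$ listed from top to bottom, $\operatorname{wt}_i(N,S;P,Q)$ denotes the weight in row $i$ (horizontal weights) of the vertex with $v_N=N$, $v_S=S$, $v_W(n+1-k)=P_k$, $v_E(n+1-k)=Q_k$ for $1\le k\le n$; similarly $\operatorname{wt}_j$ for row $j$ (vertical weights). **$R^{(n)}$-vertices.** An $R^{(n)}$-vertex $R(\boldsymbol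 I,\boldsymbol J,\boldsymbol K,\boldsymbol L)$ is a diagonal vertex with label tuples in $\{<,>\}^n$, each listed from top to bottom: $\boldsymbol I$ (upper right), $\boldsymbol J$ (lower right), $\boldsymbol K$ (lower left), $\boldsymbol L$ (upper left). The row-$i$ strand joins $\boldsymbol K$ to $\boldsymbol I$ and the row-$j$ strand joins $\boldsymbol L$ to $\boldsymbol J$. It is viewed as $n$ stacked $R^{(1)}$-vertices $r_k=(I_k,J_k,K_k,L_k)$, $1\le k\le n$ ($k=1$ on top), and its weight is $\prod_{k=1}^n\operatorname{wt}(r_k)$. The types of $R^{(1)}$-vertices, given by $(I_k,J_k,K_k,L_k)$, are: N: $(>,<,>,<)$; SS: $(>,<,<,>)$; W: $(<,<,<,<)$; E: $(>,>,>,>)$; NN: $(<,>,>,<)$; S: $(<,>,<,>)$. Any other $R^{(1)}$-vertex has weight $0$. For fixed $k$ let $$\theta''=2\,\#\{t>k:r_t=\mathrm E\},\qquad\sigma''=\#\{t<k:r_t=\mathrm{SS}\}+\#\{t>k:r_t=\mathrm{NN}\}+\#\{t:r_t=\mathrm S\}.$$ The $HV$ weights are: N: $q^{\sigma''}(-y_j)$; SS: $q^{\sigma''}(-y_j)$; W: $0$; E: $\dfrac{q^{2(n-1)}x_i-q^{\theta''}y_j}{q^{\theta''}}$; NN: $q^{\sigma''}x_i$; S: $q^{\sigma''}x_i$.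
   Formalization: In σ'' the count #{t : r_t = S} is taken over t ≠ k; as written (including t = k) the equation fails for n=1, a=α=∨, b=γ=<, c=β=>, giving x_i² on the left and q·x_i² on the right. Also q ≠ 0 is assumed so that the E weight is defined. *)

(* Defs.v *)
From HB Require Import structures.
From mathcomp Require Import all_boot all_order all_algebra.

Set Implicit Arguments.
Unset Strict Implicit.
Unset Printing Implicit Defensive.

Import GRing.Theory.
Local Open Scope ring_scope.

Inductive varrow := Up | Down.
Inductive harrow := Lt | Rt.

Definition varrow_to_bool (a : varrow) : bool := if a is Up then true else false.
Definition varrow_of_bool (b : bool) : varrow := if b then Up else Down.
Lemma varrow_to_boolK : cancel varrow_to_bool varrow_of_bool.
Proof. by case. Qed.
HB.instance Definition _ := Finite.copy varrow (can_type varrow_to_boolK).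

Definition harrow_to_bool (a : harrow) : bool := if a is Lt then true else false.
Definition harrow_of_bool (b : bool) : harrow := if b then Lt else Rt.
Lemma harrow_to_boolK : cancel harrow_to_bool harrow_of_bool.
Proof. by case. Qed.
HB.instance Definition _ := Finite.copy harrow (can_type harrow_to_boolK).

(* The ribbon size n >= 1 is written m.+1, and the strands 1, ..., n are the
   indices 0, ..., m of 'I_m.+1. *)
Notation labels m := {ffun 'I_m.+1 -> harrow}.

(* In in_arrows, ..., vvertex_wt the labels W and E are indexed from bottom to
   top; in flip, hwt, vwt and R_wt the arguments are listed from top to
   bottom. *)

Definition in_arrows m (N S : varrow) (W E : labels m) : nat :=
  (N == Down) + (S == Up) + #|[set k | W k == Rt]| + #|[set k | E k == Lt]|.

Definition out_arrows m (N S : varrow) (W E : labels m) : nat :=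
  (N == Up) + (S == Down) + #|[set k | W k == Lt]| + #|[set k | E k == Rt]|.

Definition admissible m (N S : varrow) (W E : labels m) : bool :=
  (in_arrows N S W E == out_arrows N S W E) &&
  [forall k : 'I_m.+1, forall l : 'I_m.+1, (l == k.+1 :> nat) ==> (E k == W l)].

Inductive rect_type := rSW | rNS | rSE | rNW | rEW | rNE.

Definition rect_type_of m (N S : varrow) (W E : labels m) : option rect_type :=
  if admissible N S W E then
    match N, S, W ord0, E ord_max with
    | Up,   Up,   Rt, Rt => Some rSW
    | Down, Up,   Lt, Rt => Some rNS
    | Up,   Up,   Lt, Lt => Some rSE
    | Down, Down, Rt, Rt => Some rNW
    | Up,   Down, Rt, Lt => Some rEW
    | Down, Down, Lt, Lt => Some rNE
    | _, _, _, _ => None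
    end
  else None.

Definition left_inner m (E : labels m) : nat :=
  #|[set k : 'I_m.+1 | (k < m)%N && (E k == Lt)]|.

Definition hvertex_wt (F : fieldType) (q x : F) m
    (N S : varrow) (W E : labels m) : F :=
  let s := left_inner E in
  match rect_type_of N S W E with
  | Some rSW => q ^+ s
  | Some rNS => q ^+ s
  | Some rSE => 0
  | Some rNW => 1
  | Some rEW => q ^+ s * x
  | Some rNE => q ^+ s * x
  | None => 0
  end.

Definition vvertex_wt (F : fieldType) (q y : F) m
    (N S : varrow) (W E : labels m) : F :=
  let s := left_inner E in
  match rect_type_of N S W E with
  | Some rSW => q ^+ s
  | Some rNS => 1
  | Some rSE => - y
  | Some rNW => 1
  | Some rEW => - y
  | Some rNE => 0
  | None => 0
  end.

Definition flip m (P : labels m) : labels m := [ffun k => P (rev_ord k)].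

Definition hwt (F : fieldType) (q x : F) m
    (N S : varrow) (P Q : labels m) : F :=
  hvertex_wt q x N S (flip P) (flip Q).

Definition vwt (F : fieldType) (q y : F) m
    (N S : varrow) (P Q : labels m) : F :=
  vvertex_wt q y N S (flip P) (flip Q).

Inductive R_type := RN | RSS | RW | RE | RNN | RS.

Definition R_type_to_nat (r : R_type) : nat :=
  match r with RN => 0 | RSS => 1 | RW => 2 | RE => 3 | RNN => 4 | RS => 5 end.
Definition R_type_of_nat (k : nat) : R_type :=
  match k with 0 => RN | 1 => RSS | 2 => RW | 3 => RE | 4 => RNN | _ => RS end.
Lemma R_type_to_natK : cancel R_type_to_nat R_type_of_nat.
Proof. by case. Qed.
HB.instance Definition _ := Equality.copy R_type (can_type R_type_to_natK).

Definition R_type_of (i j k l : harrow) : option R_type :=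
  match i, j, k, l with
  | Rt, Lt, Rt, Lt => Some RN
  | Rt, Lt, Lt, Rt => Some RSS
  | Lt, Lt, Lt, Lt => Some RW
  | Rt, Rt, Rt, Rt => Some RE
  | Lt, Rt, Rt, Lt => Some RNN
  | Lt, Rt, Lt, Rt => Some RS
  | _, _, _, _ => None
  end.

Definition theta2 m (r : 'I_m.+1 -> option R_type) (k : 'I_m.+1) : nat :=
  2 * #|[set t : 'I_m.+1 | (k < t)%N && (r t == Some RE)]|.

(* In the last count, t ranges over the vertices above and below the k-th one,
   but not the k-th one itself: for n = 1 the Yang-Baxter equation with
   a = alpha = Down, b = <, c = >, beta = >, gamma = < forces the weight of S
   to be x and not q * x. *)
Definition sigma2 m (r : 'I_m.+1 -> option R_type) (k : 'I_m.+1) : nat :=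
  #|[set t : 'I_m.+1 | (t < k)%N && (r t == Some RSS)]| +
  #|[set t : 'I_m.+1 | (k < t)%N && (r t == Some RNN)]| +
  #|[set t : 'I_m.+1 | (t != k) && (r t == Some RS)]|.

(* The exponent 2 * m is 2(n-1), as n = m.+1. *)
Definition HV_wt1 (F : fieldType) (q x y : F) m
    (r : 'I_m.+1 -> option R_type) (k : 'I_m.+1) : F :=
  match r k with
  | Some RN => q ^+ sigma2 r k * (- y)
  | Some RSS => q ^+ sigma2 r k * (- y)
  | Some RW => 0
  | Some RE => (q ^+ (2 * m) * x - q ^+ theta2 r k * y) / q ^+ theta2 r k
  | Some RNN => q ^+ sigma2 r k * x
  | Some RS => q ^+ sigma2 r k * x
  | None => 0
  end.

(* I, J, K, L: upper right, lower right, lower left, upper left. *)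
Definition R_wt (F : fieldType) (q x y : F) m (I J K L : labels m) : F :=
  let r := fun k => R_type_of (I k) (J k) (K k) (L k) in
  \prod_(k < m.+1) HV_wt1 q x y r k.

(* Main.v *)
Require Import Defs.
From mathcomp Require Import all_boot all_order all_algebra ring.

Set Implicit Arguments.
Unset Strict Implicit.
Unset Printing Implicit Defensive.

Import GRing.Theory.
Local Open Scope ring_scope.

(** A ribbon vertex only shifts its labels by one strand: if [P] and [Q] are its
    left and right labels, then [Q] is [P] with the last entry dropped and a new
    first entry. So a nonzero term on the left-hand side has [I] and [J] equal to
    the tails of [gamma] and [beta] followed by one free label each, and a nonzero
    term on the right-hand side has [K] and [L] equal to one free label each
    followed by [c] and [b] without their last entries. The R-stacks of the two
    sides are therefore the same stack [rs] of n-1 one-strand crossings, with one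
    further crossing added at the bottom (left-hand side) or at the top
    (right-hand side).

    The weight of [rs] factors out of both sides. For a crossing added at the top
    this can be read off the weights, since it changes the old weights only by
    powers of q: [stack_wt] is defined by this recursion, and [prod_strand_wt]
    identifies it with the product of the local weights. For a crossing added at
    the bottom it is [stack_wt_rcons], an induction on the height, which works
    because the factor gained by adding one crossing at the top and one at the
    bottom does not depend on the order of the two additions.

    What remains ([ends_yang_baxter]) involves only the six boundary labels at the
    ends of the strands and the numbers of crossings of each type in [rs]. Those
    numbers also determine the exponents of q in the rectangular weights, since
    the types record the labels, and the exponent in the weight of an additional E
    crossing, since the E and non-E crossings of [rs] are n-1 altogether. The
    claim becomes a polynomial identity for each of the 64 choices of the
    boundary labels. *)

(** * Sums and cardinals over labels *)

Lemma sum_varrow (V : nmodType) (f : varrow -> V) :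
  \sum_(d : varrow) f d = f Up + f Down.
Proof.
rewrite (reindex varrow_of_bool) ?big_bool //=.
by exists varrow_to_bool; case.
Qed.

Lemma sum_harrow (V : nmodType) (f : harrow -> V) :
  \sum_(d : harrow) f d = f Lt + f Rt.
Proof.
rewrite (reindex harrow_of_bool) ?big_bool //=.
by exists harrow_to_bool; case.
Qed.

Lemma card_set_lift n (h : 'I_n.+1) (P : pred 'I_n.+1) :
  #|[set t | P t]| = (P h + #|[set t : 'I_n | P (lift h t)]|)%N.
Proof.
rewrite -!sum1dep_card big_mkcond (bigD1_ord h) //=.
by case: (P h); congr addn; rewrite -big_mkcond.
Qed.

Lemma count_map_enum (T : eqType) (v : T) n (r : 'I_n -> T) :
  count_mem v [seq r k | k <- enum 'I_n] = #|[set t | r t == v]|.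
Proof. by rewrite cardsE cardE size_filter count_map enumT; apply: eq_count. Qed.

(** * The weight of a stack of crossings *)

(** The weight of a crossing of type E above [e] others of this type. *)
Definition E_wt (F : fieldType) (q x y : F) m e : F :=
  (q ^+ (2 * m) * x - q ^+ (2 * e) * y) / q ^+ (2 * e).

(** The types whose two strands carry different labels: all but W and E. *)
Definition mixed (r : option R_type) : bool :=
  r \in [:: Some RN; Some RSS; Some RNN; Some RS].

(** The factor gained by a stack [rs] when a crossing [r] is placed on top: the
    weight of [r] itself, times one q for each mixed crossing of [rs] when [r] is
    of type SS or S, as it then enters their exponents. *)
Definition top_factor (F : fieldType) (q x y : F) m rs (r : option R_type) : F :=
  let s := (count_mem (Some RNN) rs + count_mem (Some RS) rs)%N in
  match r with
  | Some RN => q ^+ s * (- y)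
  | Some RSS => q ^+ s * (- y) * q ^+ count mixed rs
  | Some RW => 0
  | Some RE => E_wt q x y m (count_mem (Some RE) rs)
  | Some RNN => q ^+ s * x
  | Some RS => q ^+ s * x * q ^+ count mixed rs
  | None => 0
  end.

(** The analogous factor for a crossing placed below [rs]. For type E the number
    of other E crossings appears although none is below [r]: each E crossing of
    [rs] has its exponent raised by 2, and the product telescopes to this. *)
Definition bottom_factor (F : fieldType) (q x y : F) m rs (r : option R_type) : F :=
  let s := (count_mem (Some RSS) rs + count_mem (Some RS) rs)%N in
  match r with
  | Some RN => q ^+ s * (- y)
  | Some RSS => q ^+ s * (- y)
  | Some RW => 0
  | Some RE => E_wt q x y m (count_mem (Some RE) rs)
  | Some RNN => q ^+ s * x * q ^+ count mixed rs
  | Some RS => q ^+ s * x * q ^+ count mixed rs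
  | None => 0
  end.

Fixpoint stack_wt (F : fieldType) (q x y : F) m (rs : seq (option R_type)) : F :=
  if rs is r :: rs' then top_factor q x y m rs' r * stack_wt q x y m rs' else 1.

(** By induction from the top, this reduces to the two orders of adding a top
    crossing [t] and a bottom crossing [r] giving the same factor. *)
Lemma stack_wt_rcons (F : fieldType) (q x y : F) m rs r :
  stack_wt q x y m (rcons rs r)
    = bottom_factor q x y m rs r * stack_wt q x y m rs.
Proof.
elim: rs => [|t rs IHrs] /=.
  by case: (r) => [[]|]; rewrite /= ?expr0 ?mul1r ?mulr1.
suff swap : top_factor q x y m (rcons rs r) t * bottom_factor q x y m rs r
    = bottom_factor q x y m (t :: rs) r * top_factor q x y m rs t.
  by rewrite IHrs mulrA swap !mulrA.
rewrite -cats1 /top_factor /bottom_factor !count_cat /=.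
case: t => [[]|]; case: (r) => [[]|];
  rewrite /= ?addn0 ?add0n ?(mul0r, mulr0) //;
  rewrite ?addn1 ?add1n ?addSn ?addnS ?exprS; ring.
Qed.

(** [sigma2] and [HV_wt1] with the height [n] of the stack separated from the
    ribbon size, which stays fixed in the weight of E while crossings are
    removed in an induction. *)
Definition count_sigma n (r : 'I_n -> option R_type) (k : 'I_n) : nat :=
  #|[set t : 'I_n | (t < k)%N && (r t == Some RSS)]| +
  #|[set t : 'I_n | (k < t)%N && (r t == Some RNN)]| +
  #|[set t : 'I_n | (t != k) && (r t == Some RS)]|.

Definition strand_wt (F : fieldType) (q x y : F) m n (r : 'I_n -> option R_type)
    (k : 'I_n) : F :=
  match r k with
  | Some RN | Some RSS => q ^+ count_sigma r k * (- y)
  | Some RW => 0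
  | Some RE => E_wt q x y m #|[set t : 'I_n | (k < t)%N && (r t == Some RE)]|
  | Some RNN | Some RS => q ^+ count_sigma r k * x
  | None => 0
  end.

(** The power of q on the left collects what [strand_wt_lift] splits off the
    strands below, so that [top_factor] is the full change in the weight. *)
Lemma strand_wt_ord0 (F : fieldType) (q x y : F) m n
    (r : 'I_n.+1 -> option R_type) :
  let rs := [seq r (lift ord0 k) | k <- enum 'I_n] in
  strand_wt q x y m r ord0 *
    q ^+ (((r ord0 == Some RSS) || (r ord0 == Some RS)) * count mixed rs)
  = top_factor q x y m rs (r ord0).
Proof.
rewrite /strand_wt /count_sigma /top_factor !count_map_enum.
rewrite !(card_set_lift ord0) /=.
have -> : #|[set t : 'I_n | false]| = 0%N by apply: eq_card0 => t; rewrite inE.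
rewrite !add0n.
by case: (r ord0) => [[]|] //=; rewrite ?mul0n ?mul1n ?expr0 ?mulr1 // mul0r.
Qed.

(** A top crossing of type SS or S is counted once in the exponent of every mixed
    crossing below it; for the other types no exponent below it changes. *)
Lemma strand_wt_lift (F : fieldType) (q x y : F) m n
    (r : 'I_n.+1 -> option R_type) (k : 'I_n) :
  strand_wt q x y m r (lift ord0 k)
  = strand_wt q x y m (r \o lift ord0) k *
    q ^+ (((r ord0 == Some RSS) || (r ord0 == Some RS)) * mixed (r (lift ord0 k))).
Proof.
rewrite /strand_wt.
have -> : count_sigma r (lift ord0 k)
  = (count_sigma (r \o lift ord0) k
     + ((r ord0 == Some RSS) || (r ord0 == Some RS)))%N.
  rewrite /count_sigma !(card_set_lift ord0) /= add0n -!addnA.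
  by case: (r ord0) => [[]|]; rewrite /= ?add0n ?addn0 ?add1n ?addn1 ?addnS.
rewrite (card_set_lift ord0) /= add0n.
case: (r (lift ord0 k)) => [[]|]; rewrite /= ?muln1 ?muln0 ?expr0 ?mulr1 ?mul0r //;
by rewrite exprD mulrAC.
Qed.

Lemma prod_strand_wt (F : fieldType) (q x y : F) m n (r : 'I_n -> option R_type) :
  \prod_k strand_wt q x y m r k
  = stack_wt q x y m [seq r k | k <- enum 'I_n].
Proof.
elim: n r => [|n IHn] r; first by rewrite big_ord0 enum_ord0.
rewrite big_ord_recl enum_ordSl /= -map_comp -strand_wt_ord0 -(IHn (r \o _)).
rewrite -mulrA; congr (_ * _).
under eq_bigr => k _ do rewrite strand_wt_lift.
rewrite big_split /= mulrC; congr (_ * _).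
rewrite -expr_sum -big_distrr /= -sumn_count; congr (_ ^+ (_ * _)).
by rewrite -map_comp sumnE big_map big_enum.
Qed.

Lemma R_wtE (F : fieldType) (q x y : F) m (I J K L : labels m) :
  R_wt q x y I J K L
  = stack_wt q x y m [seq R_type_of (I k) (J k) (K k) (L k) | k <- enum 'I_m.+1].
Proof.
by rewrite -(prod_strand_wt q x y m (fun k => R_type_of (I k) (J k) (K k) (L k))).
Qed.

(** * Rectangular vertices *)

(** The type of a vertex read off its four ends only; admissibility in
    [rect_type_of] amounts to [shifts], as [rect_type_flip] shows. *)
Definition end_type (N S : varrow) (w e : harrow) : option rect_type :=
  match N, S, w, e with
  | Up,   Up,   Rt, Rt => Some rSW
  | Down, Up,   Lt, Rt => Some rNS
  | Up,   Up,   Lt, Lt => Some rSE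
  | Down, Down, Rt, Rt => Some rNW
  | Up,   Down, Rt, Lt => Some rEW
  | Down, Down, Lt, Lt => Some rNE
  | _, _, _, _ => None
  end.

Definition htype_wt (F : fieldType) (q x : F) s (r : option rect_type) : F :=
  match r with
  | Some rSW => q ^+ s
  | Some rNS => q ^+ s
  | Some rSE => 0
  | Some rNW => 1
  | Some rEW => q ^+ s * x
  | Some rNE => q ^+ s * x
  | None => 0
  end.

Definition vtype_wt (F : fieldType) (q y : F) s (r : option rect_type) : F :=
  match r with
  | Some rSW => q ^+ s
  | Some rNS => 1
  | Some rSE => - y
  | Some rNW => 1
  | Some rEW => - y
  | Some rNE => 0
  | None => 0
  end.

Definition shifts m (P Q : labels m) : bool :=
  [forall t : 'I_m, Q (lift ord0 t) == P (lift ord_max t)].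

Definition left_tail m (Q : labels m) : nat :=
  #|[set t : 'I_m | Q (lift ord0 t) == Lt]|.

Lemma card_set_rev n (P : pred 'I_n) :
  #|[set t | P (rev_ord t)]| = #|[set t | P t]|.
Proof.
by rewrite -!sum1dep_card [RHS](reindex_inj rev_ord_inj).
Qed.

Lemma rev_lift0 m (t : 'I_m) : rev_ord (lift ord0 t) = lift ord_max (rev_ord t).
Proof. by apply: ord_inj; rewrite lift_max /= /bump /= add1n subSS. Qed.

Lemma rev_lift_max m (t : 'I_m) : rev_ord (lift ord_max t) = lift ord0 (rev_ord t).
Proof. by rewrite -[t in LHS]rev_ordK -rev_lift0 rev_ordK. Qed.

Lemma rev_ord0 m : rev_ord (ord0 : 'I_m.+1) = ord_max.
Proof. by apply: ord_inj; rewrite /= subSS subn0. Qed.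

Lemma rev_ord_max m : rev_ord (ord_max : 'I_m.+1) = ord0.
Proof. by apply: ord_inj; rewrite /= subnn. Qed.

Lemma left_inner_flip m (Q : labels m) : left_inner (flip Q) = left_tail Q.
Proof.
rewrite /left_inner /left_tail (card_set_lift ord_max) /= ltnn /=.
rewrite -[RHS]card_set_rev; apply: eq_card => t.
rewrite !inE /= -[bump m t]/(nat_of_ord (lift ord_max t)) lift_max ltn_ord ffunE.
by rewrite rev_lift_max.
Qed.

Lemma shifts_flip m (P Q : labels m) :
  [forall k : 'I_m.+1, forall l : 'I_m.+1,
     (l == k.+1 :> nat) ==> (flip Q k == flip P l)] = shifts P Q.
Proof.
apply/forallP/forallP => [PQ t | PQ k].
  have /forallP/(_ (rev_ord (lift ord_max t))) := PQ (rev_ord (lift ord0 t)).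
  rewrite !ffunE !rev_ordK => /implyP; apply.
  by rewrite rev_lift0 rev_lift_max lift_max.
apply/forallP => l; apply/implyP => /eqP lk; rewrite !ffunE.
have lt_km : (k < m)%N by rewrite -ltnS -lk.
have -> : k = lift ord_max (Ordinal lt_km) by apply: ord_inj; rewrite lift_max.
have -> : l = lift ord0 (Ordinal lt_km) by apply: val_inj.
by rewrite rev_lift0 rev_lift_max.
Qed.

(** The inner edges are shared by the left and the right labels, so that each of
    them contributes one arrow in and one arrow out; the balance only depends on
    the four ends, and it holds for the six types. *)
Lemma end_type_balanced m N S (P Q : labels m) :
  shifts P Q -> end_type N S (P ord_max) (Q ord0) ->
  in_arrows N S (flip P) (flip Q) = out_arrows N S (flip P) (flip Q).
Proof.
move=> /forallP PQ; rewrite /in_arrows /out_arrows.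
rewrite !(card_set_lift ord0 (fun k => flip P k == _)).
rewrite !(card_set_lift ord_max (fun k => flip Q k == _)).
have shared v : #|[set t : 'I_m | flip P (lift ord0 t) == v]|
             = #|[set t : 'I_m | flip Q (lift ord_max t) == v]|.
  apply: eq_card => t.
  by rewrite !inE !ffunE rev_lift0 rev_lift_max (eqP (PQ _)).
rewrite !shared !ffunE rev_ord0 rev_ord_max.
case: N S (P _) (Q _) => [] [] [] [] //= _;
  by rewrite ?add0n ?addn0 ?add1n ?addnS ?addSn addnC.
Qed.

Lemma rect_type_flip m N S (P Q : labels m) :
  rect_type_of N S (flip P) (flip Q)
  = if shifts P Q then end_type N S (P ord_max) (Q ord0) else None.
Proof.
rewrite /rect_type_of /admissible shifts_flip !ffunE rev_ord0 rev_ord_max.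
case: ifP => [/andP[_ ->] // | ]; case: ifP => [PQ | //].
rewrite andbT; case ends: (end_type _ _ _ _) => // /eqP[].
by apply: end_type_balanced => //; rewrite ends.
Qed.

Lemma hwtE (F : fieldType) (q x : F) m N S (P Q : labels m) :
  hwt q x N S P Q = if shifts P Q
    then htype_wt q x (left_tail Q) (end_type N S (P ord_max) (Q ord0)) else 0.
Proof.
rewrite /hwt /hvertex_wt left_inner_flip rect_type_flip.
by case: ifP.
Qed.

Lemma vwtE (F : fieldType) (q y : F) m N S (P Q : labels m) :
  vwt q y N S P Q = if shifts P Q
    then vtype_wt q y (left_tail Q) (end_type N S (P ord_max) (Q ord0)) else 0.
Proof.
rewrite /vwt /vvertex_wt left_inner_flip rect_type_flip.
by case: ifP.
Qed.

(** * The identity at the ends of the strands *)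

Lemma count_mixed rs : count mixed rs
  = (count_mem (Some RN) rs + count_mem (Some RSS) rs
     + count_mem (Some RNN) rs + count_mem (Some RS) rs)%N.
Proof.
elim: rs => //= r rs ->.
by case: r => [[]|]; rewrite /= ?add0n ?add1n ?addSn ?addnS.
Qed.

(** In a stack of [m] crossings of type E or mixed, the power of q in an E weight
    counts the mixed ones. This is the form in which it can cancel against the
    powers of q from the rectangular vertices. *)
Lemma E_wt_mixed (F : fieldType) (q x y : F) m e w :
  q != 0 -> (e + w = m)%N -> E_wt q x y m e = q ^+ (2 * w) * x - y.
Proof.
move=> q0 <-; rewrite /E_wt mulnDr exprD; field.
by rewrite expf_neq0.
Qed.

(** The Yang-Baxter equation after division by the weight of the common stack
    [rs]; the exponents in the rectangular weights are the numbers of left arrows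
    among the inner labels, expressed by the types in [rs]. *)
Lemma ends_yang_baxter (F : fieldType) (q x y : F) m rs a alpha b c beta gamma :
  q != 0 -> (count_mem (Some RE) rs + count mixed rs = m)%N ->
  let cnt r := count_mem (Some r) rs in
  \sum_i \sum_j \sum_delta
     bottom_factor q x y m rs (R_type_of i j c b)
     * htype_wt q x (cnt RNN + cnt RS) (end_type a delta i gamma)
     * vtype_wt q y (cnt RN + cnt RSS) (end_type delta alpha j beta)
  = \sum_k \sum_l \sum_xi
     vtype_wt q y (cnt RN + cnt RNN) (end_type a xi b l)
     * htype_wt q x (cnt RSS + cnt RS) (end_type xi alpha c k)
     * top_factor q x y m rs (R_type_of gamma beta k l).
Proof.
move=> q0 def_m cnt; rewrite !(sum_harrow, sum_varrow).
rewrite /top_factor /bottom_factor (E_wt_mixed x y q0 def_m) count_mixed.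
rewrite -/(cnt RN) -/(cnt RSS) -/(cnt RNN) -/(cnt RS).
(* Every exponent becomes a sum of the four counts, so that each case below is a
   polynomial identity in x, y and the four corresponding powers of q. *)
rewrite mulnC !exprM !exprD.
case: a alpha b c beta gamma => [] [] [] [] [] [];
  rewrite /= ?exprD ?(mul0r, mulr0, addr0, add0r) //; ring.
Qed.

(** * Reduction to the common stack *)

Definition insert m (T : Type) (h : 'I_m.+1) (u : 'I_m -> T) (z : T) :
    {ffun 'I_m.+1 -> T} :=
  [ffun k => if unlift h k is Some t then u t else z].

Lemma insert_lift m T (h : 'I_m.+1) (u : 'I_m -> T) z t :
  insert h u z (lift h t) = u t.
Proof. by rewrite ffunE liftK. Qed.

Lemma insert_pivot m T (h : 'I_m.+1) (u : 'I_m -> T) z : insert h u z h = z.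
Proof. by rewrite ffunE unlift_none. Qed.

(** A function that vanishes unless all entries but the one at [h] agree with [u]
    is summed over the entry at [h] alone. *)
Lemma sum_insert (V : nmodType) (T : finType) m (h : 'I_m.+1) (u : 'I_m -> T)
    (f : {ffun 'I_m.+1 -> T} -> V) :
  (forall I : {ffun 'I_m.+1 -> T}, ~~ [forall t, I (lift h t) == u t] -> f I = 0) ->
  \sum_I f I = \sum_z f (insert h u z).
Proof.
move=> f0.
rewrite (bigID (fun I : {ffun 'I_m.+1 -> T} => [forall t, I (lift h t) == u t])).
rewrite /= [X in _ + X]big1 ?addr0 //.
rewrite (reindex_onto (insert h u) (fun I => I h)) => [|I /forallP Iu].
  apply: eq_bigl => z; rewrite insert_pivot eqxx andbT.
  by apply/forallP => t; rewrite insert_lift.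
apply/ffunP => k; rewrite ffunE; case: unliftP => [t|] -> //.
by rewrite (eqP (Iu t)).
Qed.

Definition stack_types m (I J K L : 'I_m -> harrow) : seq (option R_type) :=
  [seq R_type_of (I t) (J t) (K t) (L t) | t <- enum 'I_m].

Local Notation init P := (fun t => P (lift ord_max t)).
Local Notation tail P := (fun t => P (lift ord0 t)).
Local Notation left_init P := #|[set t | P (lift ord_max t) == Lt]|.

Lemma R_wt_bottom (F : fieldType) (q x y : F) m (I J K L : labels m) :
  let rs := stack_types (init I) (init J) (init K) (init L) in
  R_wt q x y I J K L
  = bottom_factor q x y m rs
      (R_type_of (I ord_max) (J ord_max) (K ord_max) (L ord_max))
    * stack_wt q x y m rs.
Proof.
pose r k := R_type_of (I k) (J k) (K k) (L k); move=> rs.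
rewrite R_wtE enum_ordSr map_rcons stack_wt_rcons -map_comp.
by rewrite (@eq_map _ _ _ (r \o lift ord_max)) // => t /=;
   congr r; apply: ord_inj; rewrite [RHS]lift_max.
Qed.

Lemma R_wt_top (F : fieldType) (q x y : F) m (I J K L : labels m) :
  let rs := stack_types (tail I) (tail J) (tail K) (tail L) in
  R_wt q x y I J K L
  = top_factor q x y m rs (R_type_of (I ord0) (J ord0) (K ord0) (L ord0))
    * stack_wt q x y m rs.
Proof. by move=> rs; rewrite R_wtE enum_ordSl /= -map_comp. Qed.

Lemma stack_wt_neq0 (F : fieldType) (q x y : F) m rs :
  stack_wt q x y m rs != 0 -> all (fun r => (r == Some RE) || mixed r) rs.
Proof.
elim: rs => //= r rs IHrs; rewrite mulf_eq0 negb_or => /andP[r0 /IHrs ->].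
by case: r r0 => [[]|] //=; rewrite eqxx.
Qed.

(** Left arrows along one side of the stack are counted by the two types that
    show a left arrow on that side. *)
Lemma card_left m (r : 'I_m -> option R_type) (u : 'I_m -> harrow) (v w : R_type) :
  v != w ->
  (forall t, (r t == Some RE) || mixed (r t) ->
    (u t == Lt) = ((r t == Some v) || (r t == Some w))) ->
  let rs := [seq r t | t <- enum 'I_m] in
  all (fun r => (r == Some RE) || mixed r) rs ->
  #|[set t | u t == Lt]| = (count_mem (Some v) rs + count_mem (Some w) rs)%N.
Proof.
move=> neq_vw ur rs /allP rsP; rewrite -count_predUI.
rewrite [X in (_ + X)%N](@eq_count _ _ pred0) ?count_pred0 ?addn0; last first.
  by move=> z /=; case: eqP => // ->; apply/negP => /eqP[/eqP]; apply/negP.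
rewrite count_map cardsE cardE size_filter enumT.
apply: eq_count => t /=; apply: ur.
by apply/rsP/map_f; rewrite mem_enum.
Qed.

Lemma shifts_insert_max m (u : labels m) z :
  shifts (insert ord_max (tail u) z) u.
Proof. by apply/forallP => t; rewrite insert_lift. Qed.

Lemma shifts_insert0 m (u : labels m) z : shifts u (insert ord0 (init u) z).
Proof. by apply/forallP => t; rewrite insert_lift. Qed.

Lemma crossing_left_sum (F : fieldType) (q x y : F) m a alpha
    (b c beta gamma : labels m) :
  let rs := stack_types (tail gamma) (tail beta) (init c) (init b) in
  \sum_I \sum_J \sum_delta
     R_wt q x y I J c b * hwt q x a delta I gamma * vwt q y delta alpha J beta
  = (\sum_i \sum_j \sum_delta
       bottom_factor q x y m rs (R_type_of i j (c ord_max) (b ord_max))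
       * htype_wt q x (left_tail gamma) (end_type a delta i (gamma ord0))
       * vtype_wt q y (left_tail beta) (end_type delta alpha j (beta ord0)))
    * stack_wt q x y m rs.
Proof.
move=> rs; rewrite big_distrl /=.
rewrite (sum_insert (h := ord_max) (u := tail gamma)) => [|I nI]; last first.
  rewrite big1 // => J _; rewrite big1 // => d _.
  rewrite hwtE ifN ?mulr0 ?mul0r //; apply: contra nI => /forallP nI.
  by apply/forallP => t; rewrite eq_sym nI.
apply: eq_bigr => i _; rewrite big_distrl /=.
rewrite (sum_insert (h := ord_max) (u := tail beta)) => [|J nJ]; last first.
  rewrite big1 // => d _.
  rewrite vwtE ifN ?mulr0 //; apply: contra nJ => /forallP nJ.
  by apply/forallP => t; rewrite eq_sym nJ.
apply: eq_bigr => j _; rewrite big_distrl /=; apply: eq_bigr => d _.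
rewrite R_wt_bottom hwtE vwtE !shifts_insert_max !insert_pivot.
have -> : stack_types (init (insert ord_max (tail gamma) i))
    (init (insert ord_max (tail beta) j)) (init c) (init b) = rs.
  by apply: eq_map => t; rewrite !insert_lift.
by rewrite [RHS]mulrAC; congr (_ * _); rewrite mulrAC.
Qed.

Lemma crossing_right_sum (F : fieldType) (q x y : F) m a alpha
    (b c beta gamma : labels m) :
  let rs := stack_types (tail gamma) (tail beta) (init c) (init b) in
  \sum_K \sum_L \sum_xi
     vwt q y a xi b L * hwt q x xi alpha c K * R_wt q x y gamma beta K L
  = (\sum_k \sum_l \sum_xi
       vtype_wt q y (left_init b) (end_type a xi (b ord_max) l)
       * htype_wt q x (left_init c) (end_type xi alpha (c ord_max) k)
       * top_factor q x y m rs (R_type_of (gamma ord0) (beta ord0) k l))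
    * stack_wt q x y m rs.
Proof.
move=> rs; rewrite big_distrl /=.
rewrite (sum_insert (h := ord0) (u := init c)) => [|K nK]; last first.
  rewrite big1 // => L _; rewrite big1 // => d _.
  by rewrite hwtE ifN ?mulr0 ?mul0r.
apply: eq_bigr => k _; rewrite big_distrl /=.
rewrite (sum_insert (h := ord0) (u := init b)) => [|L nL]; last first.
  by rewrite big1 // => d _; rewrite vwtE ifN ?mul0r.
apply: eq_bigr => l _; rewrite big_distrl /=; apply: eq_bigr => d _.
rewrite R_wt_top hwtE vwtE !shifts_insert0 !insert_pivot.
have -> : stack_types (tail gamma) (tail beta)
    (tail (insert ord0 (init c) k)) (tail (insert ord0 (init b) l)) = rs.
  by apply: eq_map => t; rewrite !insert_lift.
rewrite mulrA; congr (vtype_wt _ _ _ _ * htype_wt _ _ _ _ * _ * _);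
by apply: eq_card => t; rewrite !inE insert_lift.
Qed.

Theorem theorem5p3 (F : fieldType) (q x_i y_j : F) (hq : q != 0) (m : nat)
    (a alpha : varrow) (b c beta gamma : labels m) :
  \sum_(I : labels m) \sum_(J : labels m) \sum_(delta : varrow)
     R_wt q x_i y_j I J c b * hwt q x_i a delta I gamma * vwt q y_j delta alpha J beta
  = \sum_(K : labels m) \sum_(L : labels m) \sum_(xi : varrow)
     vwt q y_j a xi b L * hwt q x_i xi alpha c K * R_wt q x_i y_j gamma beta K L.
Proof.
rewrite crossing_left_sum crossing_right_sum /left_tail.
set rs := stack_types _ _ _ _; set mid := stack_wt _ _ _ _ rs.
(* A crossing of type W, or of no type, in the common stack kills both sides. *)
have [-> | /stack_wt_neq0 rsP] := eqVneq mid 0; first by rewrite !mulr0.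
congr (_ * _).
have size_rs : (count_mem (Some RE) rs + count mixed rs = m)%N.
  rewrite -count_predUI [X in (_ + X)%N](@eq_count _ _ pred0) => [|[[]|]] //.
  rewrite count_pred0 addn0; move: rsP; rewrite all_count => /eqP ->.
  by rewrite size_map size_enum_ord.
have -> : #|[set t | gamma (lift ord0 t) == Lt]|
    = (count_mem (Some RNN) rs + count_mem (Some RS) rs)%N.
  apply: card_left rsP => // t.
  by case: (gamma _) (beta _) (c _) (b _) => [] [] [] [].
have -> : #|[set t | beta (lift ord0 t) == Lt]|
    = (count_mem (Some RN) rs + count_mem (Some RSS) rs)%N.
  apply: card_left rsP => // t.
  by case: (gamma _) (beta _) (c _) (b _) => [] [] [] [].
have -> : left_init b = (count_mem (Some RN) rs + count_mem (Some RNN) rs)%N.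
  apply: card_left rsP => // t.
  by case: (gamma _) (beta _) (c _) (b _) => [] [] [] [].
have -> : left_init c = (count_mem (Some RSS) rs + count_mem (Some RS) rs)%N.
  apply: card_left rsP => // t.
  by case: (gamma _) (beta _) (c _) (b _) => [] [] [] [].
exact: ends_yang_baxter.
Qed.
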